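(* Let $\mathcal T$ be a péijí topology on $\mathbb Z$ of Brown type, let $\{\mathcal T_n\}_{n\in\mathbb N_1}$ be the maximal family inducing it and let $\mathcal M\subseteq\mathbb N_1$ be a determining monoid for $\mathcal T$ satisfying conditions (B1) and (B2). Assume $[a]_n\in B_n$ for some $a\in\mathbb Z$ and $n\in\mathcal M$. Then $a+n\mathbb Z$ and $a+n\mathbb N$ (with the subspace topologies induced by $\mathcal T$) are superconnected. In particular, if $\mathcal T$ is of Brown type then $(\mathbb Z,\mathcal T)$, $(\mathbb N,\mathcal T)$ and $(\mathbb N_1,\mathcal T)$ are superconnected.
   Context: Notation: $\mathbb N=\{0,1,2,\dots\}$, $\mathbb N_1=\mathbb N-\{0\}$; $\pi_n\colon\mathbb Z\to\mathbb Z/n\mathbb Z$, $a\mapsto[a]_n$, is reduction modulo $n$; if $n$ divides $m$, $\pi_n^m\colon\mathbb Z/m\mathbb Z\to\mathbb Z/n\mathbb Z$ is the natural projection. Subsets of $\mathbb Z$ carry the subspace topology. Péijí topologies: a family $\{\mathcal T_n\}_{n\in\mathbb N_1}$ of topologies, $\mathcal T_n$ on $\mathbb Z/n\mathbb Z$, induces the coarsest topology $\mathcal T$ on $\mathbb Z$ such that all maps $\pi_n\colon(\mathbb Z,\mathcal T)\to(\mathbb Z/n\mathbb Z,\mathcal T_n)$ are continuous. A péijí topology is a topology on $\mathbb Z$ obtained in this way. Two families are equivalent if they induce the same topology on $\mathbb Z$; a family is maximal if each $\mathcal T_n$ is the finest possible among all families in its equivalence class. The maximal family of $\mathcal T$ consists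 of the quotient topologies: $A\subseteq\mathbb Z/n\mathbb Z$ is in $\mathcal T_n$ iff $\pi_n^{-1}(A)\in\mathcal T$. Determining monoid: let $\mathcal T$ be a péijí topology with maximal family $\{\mathcal T_n\}$. A nonempty subset $\mathcal M\subseteq\mathbb N_1$ is a determining set for $\mathcal T$ if $\{\mathcal T_n\}$ is equivalent to the family $\{\mathcal T'_n\}$ with $\mathcal T_n'=\mathcal T_n$ for $n\in\mathcal M$ and $\mathcal T_n'$ the trivial topology otherwise. It is a determining monoid if moreover it is a multiplicative submonoid of $\mathbb N_1$ (in particular $1\in\mathcal M$). $B_n$ denotes the intersection of all nonempty closed subsets of $(\mathbb Z/n\mathbb Z,\mathcal T_n)$, where $\{\mathcal T_n\}$ is the maximal family. $\mathcal T$ is of Brown type if it admits a determining monoid $\mathcal M$ such that for all $n,m\in\mathcal M$ with $n$ dividing $m$: (B1) the map $\pi_n^m\colon(\mathbb Z/m\mathbb Z,\mathcal T_m)\to(\mathbb Z/n\mathbb Z,\mathcal T_n)$ is open; (B2) $\pi_n^m(B_m)=B_n$. A topological space $X$ is superconnected if for any $r\in\mathbb N_1$ and any nonempty open subsets $U_1,\dots,U_r$ of $X$ one has $\bigcap_{i=1}^r\overline{U_i}\neq\emptyset$. *)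

(* Defs.v *)
From HB Require Import structures.
From mathcomp Require Import all_boot all_order all_algebra.
From mathcomp Require Import all_classical all_reals all_analysis.

Set Implicit Arguments.
Unset Strict Implicit.
Unset Printing Implicit Defensive.

Import Order.TTheory GRing.Theory Num.Theory.
Local Open Scope classical_set_scope.
Local Open Scope ring_scope.

(* The library's topologicalType attaches a topology to a type; here several
   topologies on the same type are compared, so a topology is a value, and
   [top_space T] is a copy of X carrying the structure given by T. *)
Record topology (X : choiceType) := Topology {
  opens : set (set X);
  opensT : opens setT;
  opensI : setI_closed opens;
  opens_bigcup : forall D : set (set X),
    D `<=` opens -> opens (\bigcup_(U in D) U) }.

Definition top_space (X : choiceType) (T : topology X) : Type := X.

Section Space.
Variables (X : choiceType) (T : topology X).

Let opens_bigcupT (I : Type) (f : I -> set (top_space T)) :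
  (forall i, opens T (f i)) -> opens T (\bigcup_i f i).
Proof.
move=> fT; suff -> : \bigcup_i f i = \bigcup_(U in range f) U.
  by apply: opens_bigcup => _ [i _ <-].
by rewrite bigcup_image.
Qed.

HB.instance Definition _ := Choice.copy (top_space T) X.
HB.instance Definition _ :=
  isOpenTopological.Build (top_space T) (opensT T) (@opensI _ T) opens_bigcupT.

End Space.

Section Trivial.
Variable X : choiceType.

Let triv : set (set X) := [set U | U = set0 \/ U = setT].

Let trivT : triv setT. Proof. by right. Qed.

Let trivI : setI_closed triv.
Proof. by move=> A B [->|->] hB; rewrite ?set0I ?setTI //; left. Qed.

Let triv_bigcup (D : set (set X)) : D `<=` triv -> triv (\bigcup_(U in D) U).
Proof.
move=> DT; have [DsT|nDT] := pselect (D setT).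
  by right; apply/seteqP; split=> // x _; exists setT.
left; apply: bigcup0 => U DU; case: (DT _ DU) => // UT.
by rewrite UT in DU.
Qed.

Definition trivial_topology := Topology trivT trivI triv_bigcup.

End Trivial.

Definition superconnected (X : topologicalType) : Prop :=
  forall (r : nat) (U : 'I_r -> set X), (0 < r)%N ->
    (forall i, open (U i) /\ U i !=set0) ->
    \bigcap_i closure (U i) !=set0.

Definition open_map (X Y : topologicalType) (f : X -> Y) : Prop :=
  forall U : set X, open U -> open (f @` U).

(* For n > 0 this is {0, ..., n-1} = 'I_n, the residues modulo n (including
   n = 1, unlike 'Z_n); the value at n = 0 is irrelevant. *)
Definition Zmod (n : nat) := 'I_n.-1.+1.

Definition pi_mod (n : nat) (a : int) : Zmod n := inord `|(a %% n%:Z)%Z|%N.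

(* pi^m_n : Z/m -> Z/n, meaningful when n divides m. *)
Definition pi_proj (m n : nat) (x : Zmod m) : Zmod n :=
  pi_mod n (nat_of_ord x)%:Z.
Arguments pi_proj : clear implicits.

Definition zmod_topologies := forall n : nat, topology (Zmod n).

Definition all_pi_continuous (T : topology int) (F : zmod_topologies) : Prop :=
  forall n : nat, (0 < n)%N -> continuous (pi_mod n : top_space T -> top_space (F n)).

Definition induces (F : zmod_topologies) (T : topology int) : Prop :=
  all_pi_continuous T F /\
  forall T' : topology int, all_pi_continuous T' F -> opens T `<=` opens T'.

Definition peiji (T : topology int) : Prop := exists F : zmod_topologies, induces F T.

Definition equivalent_families (F G : zmod_topologies) : Prop :=
  forall T : topology int, induces F T <-> induces G T.

Definition maximal_family (F : zmod_topologies) : Prop :=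
  forall G : zmod_topologies, equivalent_families F G ->
    forall n : nat, (0 < n)%N -> opens (G n) `<=` opens (F n).

Definition restrict_family (F : zmod_topologies) (M : set nat) : zmod_topologies :=
  fun n => if n \in M then F n else trivial_topology (Zmod n).

(* F is meant to be the maximal family of the topology. *)
Definition determining_set (F : zmod_topologies) (M : set nat) : Prop :=
  [/\ M !=set0, M `<=` [set n | (0 < n)%N] &
      equivalent_families F (restrict_family F M)].

Definition determining_monoid (F : zmod_topologies) (M : set nat) : Prop :=
  [/\ determining_set F M, M 1%N &
      forall m n : nat, M m -> M n -> M (m * n)%N].

Definition Bset (F : zmod_topologies) (n : nat) : set (Zmod n) :=
  \bigcap_(C in [set C : set (top_space (F n)) | closed C /\ C !=set0]) C.
Arguments Bset : clear implicits.

Definition condB1 (F : zmod_topologies) (M : set nat) : Prop :=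
  forall n m : nat, M n -> M m -> (n %| m)%N ->
    open_map (pi_proj m n : top_space (F m) -> top_space (F n)).

Definition condB2 (F : zmod_topologies) (M : set nat) : Prop :=
  forall n m : nat, M n -> M m -> (n %| m)%N ->
    pi_proj m n @` Bset F m = Bset F n.

Definition brown_type (T : topology int) : Prop :=
  peiji T /\
  exists (F : zmod_topologies) (M : set nat),
    [/\ induces F T, maximal_family F, determining_monoid F M, condB1 F M &
        condB2 F M].

(* A with the subspace topology: the library puts on [set_type A] the initial
   topology of the inclusion. *)
Definition superconnected_in (T : topology int) (A : set int) : Prop :=
  superconnected (set_type (A : set (top_space T))).

(* Main.v *)
(* A class lies in [B_n] exactly when its only open neighbourhood is all of Z/n.
   Given finitely many nonempty open subsets of the progression, choose m in the
   monoid, divisible by n, such that each contains all the points of the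
   progression in some class x_i + mZ, and a point b of the progression with
   [b]_m in [B_m].  A basic neighbourhood of b is a union W of classes modulo
   some multiple l of m; its image in Z/m is open and contains [b]_m, hence is
   everything, so W meets every x_i + mZ: b is in all the closures. *)
Require Import Defs.
From mathcomp Require Import all_boot all_order all_algebra.
From mathcomp Require Import all_classical all_reals all_analysis.
From mathcomp Require Import ring.

Set Implicit Arguments.
Unset Strict Implicit.
Unset Printing Implicit Defensive.

Import Order.TTheory GRing.Theory Num.Theory.
Local Open Scope classical_set_scope.
Local Open Scope ring_scope.

Lemma topology_eq (X : choiceType) (S T : topology X) :
  opens S = opens T -> S = T.
Proof.
case: S T => [s s1 s2 s3] [t t1 t2 t3] /= st; case: t / st t1 t2 t3 => *.
by congr Topology; exact: Prop_irrelevance.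
Qed.

(** * Reduction modulo [n] and the projections between residue rings *)

Lemma val_pi_mod (n : nat) (x : int) : (0 < n)%N ->
  (nat_of_ord (pi_mod n x))%:Z = (x %% n%:Z)%Z.
Proof.
move=> n0; have nZ : n%:Z != 0 by rewrite eqz_nat -lt0n.
rewrite /pi_mod inordK; first by rewrite gez0_abs // modz_ge0.
by rewrite prednK // -ltz_nat gez0_abs ?modz_ge0 // ltz_pmod.
Qed.

Lemma pi_modP (n : nat) (x y : int) : (0 < n)%N ->
  pi_mod n x = pi_mod n y <-> (n%:Z %| x - y)%Z.
Proof.
move=> n0; split=> [e|].
  by rewrite -eqz_mod_dvd -!val_pi_mod // e.
by rewrite -eqz_mod_dvd => /eqP e; rewrite /pi_mod e.
Qed.

Lemma pi_mod_surj (n : nat) (u : Zmod n) : (0 < n)%N ->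
  pi_mod n (nat_of_ord u)%:Z = u.
Proof.
move=> n0; apply: val_inj; apply/eqP; rewrite -eqz_nat val_pi_mod //.
by rewrite modz_small //= ltz_nat -[n in (_ < n)%N]prednK.
Qed.

Lemma pi_proj_mod (m n : nat) (x : int) : (0 < m)%N -> (n %| m)%N ->
  pi_proj m n (pi_mod m x) = pi_mod n x.
Proof.
move=> m0 nm; rewrite /pi_proj; apply/pi_modP; first exact: dvdn_gt0 m0 nm.
rewrite val_pi_mod // (@dvdz_trans m%:Z) // -eqz_mod_dvd; apply/eqP.
by rewrite modz_mod.
Qed.

(** * Induced topologies and their quotients *)

Lemma inducesP (F : zmod_topologies) (S T : topology int) :
  induces F T -> induces F S -> S = T.
Proof.
move=> [cT mT] [cS mS]; apply: topology_eq; apply/seteqP; split.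
  exact: mS.
exact: mT.
Qed.

Lemma all_pi_continuousP (T : topology int) (F : zmod_topologies) :
  all_pi_continuous T F <-> forall n, (0 < n)%N ->
    forall V, opens (F n) V -> opens T (pi_mod n @^-1` V).
Proof.
split=> H n n0; first by move=> V; move/continuousP: (H n n0); apply.
by apply/continuousP => V; apply: H.
Qed.

Section QuotientTopology.
Context (T : topology int) (n : nat).

Let quot : set (set (Zmod n)) := [set V | opens T (pi_mod n @^-1` V)].

Let quotT : quot setT. Proof. exact: opensT. Qed.

Let quotI : setI_closed quot.
Proof. by move=> A B qA qB; exact: opensI. Qed.

Let quot_bigcup (D : set (set (Zmod n))) :
  D `<=` quot -> quot (\bigcup_(V in D) V).
Proof.
move=> Dq; rewrite /quot /= preimage_bigcup.
rewrite -(bigcup_image D (preimage (pi_mod n)) id).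
by apply: opens_bigcup => _ [V DV <-]; exact: Dq.
Qed.

Definition quotient_topology := Topology quotT quotI quot_bigcup.

End QuotientTopology.

(** The quotient topologies of [T] contain those of [F], so they induce [T] too; maximality of [F]
    then puts them inside [F]. *)
Lemma maximal_quotient (T : topology int) (F : zmod_topologies) :
  induces F T -> maximal_family F -> forall (n : nat) (V : set (Zmod n)),
  (0 < n)%N -> opens T (pi_mod n @^-1` V) -> opens (F n) V.
Proof.
move=> FT maxF n V n0 TV.
have QT : induces (quotient_topology T) T.
  split; first exact/all_pi_continuousP.
  move=> S /all_pi_continuousP cS; apply: FT.2; apply/all_pi_continuousP => k k0.
  move=> W FW; apply: cS => //.
  by move/all_pi_continuousP: FT.1; apply.
apply: (maxF (quotient_topology T)) => // S; split=> [FS|QS].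
  by rewrite (inducesP FT FS).
by rewrite (inducesP QT QS).
Qed.

(** * Basic neighbourhoods with levels in the monoid *)

Section NeighbourhoodBasis.
Context (T : topology int) (F : zmod_topologies) (M : set nat).
Hypotheses (FT : induces F T) (maxF : maximal_family F).
Hypothesis monM : determining_monoid F M.

Lemma monoid_gt0 m : M m -> (0 < m)%N.
Proof. by case: monM => -[_ Mpos _] _ _; exact: Mpos. Qed.

Lemma open_preimage_pi m (V : set (Zmod m)) :
  M m -> opens (F m) V -> opens T (pi_mod m @^-1` V).
Proof.
by move=> /monoid_gt0 m0; move: V; move/all_pi_continuousP: FT.1; apply.
Qed.

(** Moves basic sets of different levels to a common multiple. The pullback of [V] to level [l] has
    the same preimage in the integers, which is open in [T]; maximality of [F] makes the pullback
    open. *)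
Lemma open_refine (m l : nat) (V : set (Zmod m)) :
  M m -> M l -> (m %| l)%N -> opens (F m) V ->
  exists2 W, opens (F l) W & pi_mod l @^-1` W = pi_mod m @^-1` V.
Proof.
move=> Mm Ml ml FV; have l0 := monoid_gt0 Ml.
have eW : pi_mod l @^-1` (pi_proj l m @^-1` V) = pi_mod m @^-1` V.
  by apply/seteqP; split=> x /=; rewrite pi_proj_mod.
exists (pi_proj l m @^-1` V) => //.
by apply: (maximal_quotient FT maxF) => //; rewrite eW; exact: open_preimage_pi.
Qed.

Let basic (U : set int) (x : int) := exists m (V : set (Zmod m)),
  [/\ M m, opens (F m) V, V (pi_mod m x) & pi_mod m @^-1` V `<=` U].

Let generated : set (set int) := [set U | U `<=` basic U].

Let generatedT : generated setT.
Proof.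
case: monM => _ M1 _ x _; exists 1%N, setT; split=> //; exact: opensT.
Qed.

Let generatedI : setI_closed generated.
Proof.
move=> U U' gU gU' x [/gU [m [V [Mm FV Vx VU]]] /gU' [m' [V' [Mm' FV' Vx' VU']]]].
have Mmm : M (m * m')%N by case: monM => _ _; apply.
have [W FW eW] := open_refine Mm Mmm (dvdn_mulr _ (dvdnn m)) FV.
have [W' FW' eW'] := open_refine Mm' Mmm (dvdn_mull _ (dvdnn m')) FV'.
exists (m * m')%N, (W `&` W'); split=> //.
- exact: opensI.
- by split; [change ((pi_mod (m * m') @^-1` W) x); rewrite eW
            |change ((pi_mod (m * m') @^-1` W') x); rewrite eW'].
- by rewrite preimage_setI eW eW'; exact: setISS.
Qed.

Let generated_bigcup (D : set (set int)) :
  D `<=` generated -> generated (\bigcup_(U in D) U).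
Proof.
move=> Dg x [U DU Ux]; have [m [V [Mm FV Vx VU]]] := Dg _ DU _ Ux.
by exists m, V; split=> // y /VU Uy; exists U.
Qed.

(** Since [M] is determining, [T] is the coarsest topology making the maps of the restricted family
    continuous. The sets in [generated] form such a topology, so it contains [T]. *)
Lemma peiji_basis (U : set int) (x : int) : opens T U -> U x ->
  exists m (V : set (Zmod m)),
  [/\ M m, opens (F m) V, V (pi_mod m x) & pi_mod m @^-1` V `<=` U].
Proof.
move=> TU Ux; case: monM => -[_ _ eqF] _ _.
have [_ /(_ (Topology generatedT generatedI generated_bigcup))] := (eqF T).1 FT.
apply=> //; apply/all_pi_continuousP => k k0 V.
rewrite /restrict_family; case: ifPn => [/set_mem Mk FV y Vy|_].
  by exists k, V; split.
by case=> ->; [rewrite preimage_set0 => ? []|exact: generatedT].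
Qed.

Lemma peiji_basis_dvd (U : set int) (x : int) (k : nat) :
  opens T U -> U x -> M k -> exists m (V : set (Zmod m)),
  [/\ M m, (k %| m)%N, opens (F m) V, V (pi_mod m x) &
      pi_mod m @^-1` V `<=` U].
Proof.
move=> TU Ux Mk; have [m [V [Mm FV Vx VU]]] := peiji_basis TU Ux.
have Mkm : M (k * m)%N by case: monM => _ _; apply.
have [W FW eW] := open_refine Mm Mkm (dvdn_mull _ (dvdnn m)) FV.
exists (k * m)%N, W; split=> //; first exact: dvdn_mulr.
  by change ((pi_mod (k * m) @^-1` W) x); rewrite eW.
by rewrite eW.
Qed.

End NeighbourhoodBasis.

(** A nonempty complement of [V] would be one of the closed sets intersected in [Bset F n], and so
    would contain [u]. *)
Lemma Bset_nbhs (F : zmod_topologies) (n : nat) (u : Zmod n) (V : set (Zmod n)) :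
  Bset F n u -> opens (F n) V -> V u -> V = setT.
Proof.
move=> Bu FV Vu; rewrite -[V]setCK -[RHS]setCK setCT; congr (~` _).
apply: contrapT => /eqP/set0P V0.
have : (~` V) u by apply: Bu; split=> //; rewrite closedC.
exact.
Qed.

(* Both [a + nZ] and [a + nN] satisfy the two hypotheses on [A]. *)
Lemma brown_closures_meet (T : topology int) (F : zmod_topologies) (M : set nat)
    (a : int) (n : nat) (A : set int) :
  induces F T -> maximal_family F -> determining_monoid F M ->
  condB1 F M -> condB2 F M -> M n -> Bset F n (pi_mod n a) ->
  (forall x, A x -> (n%:Z %| x - a)%Z) ->
  (forall x (m : nat), (0 < m)%N -> (n %| m)%N -> (n%:Z %| x - a)%Z ->
    exists2 y, A y & (m%:Z %| y - x)%Z) ->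
  forall (r : nat) (U : 'I_r -> set int),
  (forall i, opens T (U i) /\ U i `&` A !=set0) ->
  exists2 b, A b & forall i O, opens T O -> O b -> O `&` (U i `&` A) !=set0.
Proof.
move=> FT maxF monM B1 B2 Mn Ba Asub Adense r U hU.
have gt0 := @monoid_gt0 _ _ monM.
(* [p i] consists of a point x_i of [U i] in [A] and a level m_i such that the whole class x_i + m_i
   Z lies in [U i]. *)
have /choice[p hp] : forall i, exists p : int * nat,
    [/\ A p.1, M p.2 & forall y, (p.2%:Z %| y - p.1)%Z -> U i y].
  move=> i; have [TU [x [Ux Ax]]] := hU i.
  have [m [V [Mm FV Vx VU]]] := peiji_basis FT maxF monM TU Ux.
  exists (x, m); split=> // y yx.
  by apply: VU => /=; rewrite ((pi_modP _ _ (gt0 _ Mm)).2 yx).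
(* The factor [n] allows (B2) to lift the class of [a]; the product makes [m] a multiple of every
   m_i. *)
pose m := (n * \prod_(i < r) (p i).2)%N.
have MM : forall k l, M k -> M l -> M (k * l)%N by case: monM.
have Mm : M m.
  apply: (MM) => //; apply: (big_ind M) => // [|i _]; first by case: monM.
  by case: (hp i).
have nm : (n %| m)%N by exact: dvdn_mulr.
have pm i : ((p i).2 %| m)%N.
  by rewrite /m (bigD1 i) //= mulnCA dvdn_mulr.
(* The lift [c] given by (B2) is congruent to [a] modulo [n], so [A] contains some [b] in the class
   [c]. *)
have [c Bc ca] : (pi_proj m n @` Bset F m) (pi_mod n a) by rewrite B2.
have [|b Ab cb] := Adense (nat_of_ord c)%:Z m (gt0 _ Mm) nm.
  by apply/pi_modP; [exact: gt0|].
have Bb : Bset F m (pi_mod m b).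
  by rewrite ((pi_modP _ _ (gt0 _ Mm)).2 cb) pi_mod_surj //; exact: gt0.
exists b => // i O TO Ob.
have [l [W [Ml ml FW Wb WO]]] := peiji_basis_dvd FT maxF monM TO Ob Mm.
have [Ap Mp Up] := hp i.
have l0 := gt0 _ Ml.
(* By (B1) the image of [W] is open; it contains the class of [b], which lies in [Bset F m], so it
   is everything and reaches the class of x_i. *)
have [w Ww wp] : (pi_proj l m @` W) (pi_mod m (p i).1).
  rewrite (Bset_nbhs Bb (B1 _ _ Mm Ml ml W FW)) //.
  by exists (pi_mod l b) => //; rewrite pi_proj_mod.
have {wp} wp : (m%:Z %| (nat_of_ord w)%:Z - (p i).1)%Z.
  by apply/pi_modP => //; exact: gt0.
have wa : (n%:Z %| (nat_of_ord w)%:Z - a)%Z.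
  have -> : (nat_of_ord w)%:Z - a
      = (nat_of_ord w)%:Z - (p i).1 + ((p i).1 - a) by ring.
  by rewrite rpredD ?Asub // (dvdz_trans _ wp).
(* A point of [A] in the class [w] modulo [l] lies in [O] because [w] is in [W], and in [U i]
   because m_i divides [m], which divides [l]. *)
have [y Ay yw] := Adense _ l l0 (dvdn_trans nm ml) wa.
exists y; split; last split=> //.
  by apply: WO => /=; rewrite ((pi_modP _ _ l0).2 yw) pi_mod_surj.
apply: Up; have -> : y - (p i).1
    = (y - (nat_of_ord w)%:Z) + ((nat_of_ord w)%:Z - (p i).1) by ring.
rewrite rpredD ?(dvdz_trans _ wp) ?(dvdz_trans _ yw) //.
  exact: dvdn_trans (pm i) ml.
exact: pm.
Qed.

(** Open sets of the subspace are traces of open sets of [T], so closures in [A] can be tested among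
    integers. *)
Lemma superconnected_inP (T : topology int) (A : set int) :
  (forall (r : nat) (U : 'I_r -> set int),
    (forall i, opens T (U i) /\ U i `&` A !=set0) ->
    exists2 b, A b & forall i O, opens T O -> O b -> O `&` (U i `&` A) !=set0) ->
  superconnected_in T A.
Proof.
move=> HA r U _ hU.
have /choice[P hP] : forall i, exists P : set int,
    opens T P /\ set_val @^-1` P = U i.
  by move=> i; have [[P TP PU] _] := hU i; exists P.
have [|b Ab Hb] := HA r P.
  move=> i; have [TP PU] := hP i; split=> //.
  have [_ [z]] := hU i; rewrite -PU => Pz; exists (set_val z); split=> //.
  exact: set_valP.
exists (SigSub (mem_set Ab)) => i _ N.
rewrite nbhsE => -[N' [[Q TQ <-] Qb] N'N].
have [y [Qy [Py Ay]]] := Hb i Q TQ Qb.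
exists (SigSub (mem_set Ay)); split; last exact: N'N.
by have [_ <-] := hP i.
Qed.

Lemma superconnectedP (T : topology int) :
  (forall (r : nat) (U : 'I_r -> set int),
    (forall i, opens T (U i) /\ U i `&` setT !=set0) ->
    exists2 b, setT b &
      forall i O, opens T O -> O b -> O `&` (U i `&` setT) !=set0) ->
  superconnected (top_space T).
Proof.
move=> HT r U _ hU; have [|b _ Hb] := HT r U.
  by move=> i; rewrite setIT; exact: hU.
exists b => i _ N; rewrite nbhsE => -[N' [TN' N'b] N'N].
have [y [N'y [Uy _]]] := Hb i N' TN' N'b.
by exists y; split=> //; exact: N'N.
Qed.

Lemma progression_sub (a : int) (n : nat) (x : int) :
  [set a + n%:Z * k | k in [set: int]] x -> (n%:Z %| x - a)%Z.
Proof. by move=> [k _ <-]; rewrite addrC addKr dvdz_mulr. Qed.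

Lemma progression_nat_sub (a : int) (n : nat) :
  [set a + n%:Z * k%:Z | k in [set: nat]]
  `<=` [set a + n%:Z * k | k in [set: int]].
Proof. by move=> _ [k _ <-]; exists k%:Z. Qed.

Lemma progression_nat_dense (a : int) (n : nat) (x : int) (m : nat) :
  (0 < m)%N -> (n %| m)%N -> (n%:Z %| x - a)%Z ->
  exists2 y, [set a + n%:Z * k%:Z | k in [set: nat]] y & (m%:Z %| y - x)%Z.
Proof.
move=> m0 /dvdnP[q mE] /dvdzP[k xk].
have q0 : (0 < q)%N by move: m0; rewrite mE muln_gt0 => /andP[].
(* With x = a + nk and m = qn, adding q|k| to [k] shifts x by |k|m, and makes the coefficient
   nonnegative because q is at least 1. *)
exists (a + n%:Z * (k + q%:Z * `|k|)).
  exists (absz (k + q%:Z * `|k|)) => //; rewrite gez0_abs //.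
  rewrite -[k in k + _]opprK addrC subr_ge0 (le_trans (ler_norm _)) // normrN.
  by rewrite ler_peMl // lez_nat.
have -> : a + n%:Z * (k + q%:Z * `|k|) - x = `|k| * m%:Z.
  by rewrite mE PoszM -[x](subrK a) xk; ring.
exact: dvdz_mull.
Qed.

Theorem theorem2p25 (T : topology int) (hT : brown_type T) :
  (forall (F : zmod_topologies) (M : set nat),
     induces F T -> maximal_family F -> determining_monoid F M ->
     condB1 F M -> condB2 F M ->
     forall (a : int) (n : nat), M n -> Bset F n (pi_mod n a) ->
       superconnected_in T [set a + n%:Z * k | k in [set: int]] /\
       superconnected_in T [set a + n%:Z * k%:Z | k in [set: nat]]) /\
  [/\ superconnected (top_space T),
      superconnected_in T [set k%:Z | k in [set: nat]] &
      superconnected_in T [set k%:Z | k in [set k : nat | (0 < k)%N]]].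
Proof.
(* Any [A] between a + nN and a + nZ is treated at once: it stays in the class of [a] and inherits
   density from the smaller progression. *)
have main F M : induces F T -> maximal_family F -> determining_monoid F M ->
    condB1 F M -> condB2 F M -> forall (a : int) (n : nat), M n ->
    Bset F n (pi_mod n a) -> forall A : set int,
    [set a + n%:Z * k%:Z | k in [set: nat]] `<=` A ->
    A `<=` [set a + n%:Z * k | k in [set: int]] ->
    forall (r : nat) (U : 'I_r -> set int),
    (forall i, opens T (U i) /\ U i `&` A !=set0) ->
    exists2 b, A b & forall i O, opens T O -> O b -> O `&` (U i `&` A) !=set0.
  move=> FT maxF monM B1 B2 a n Mn Ba A subA Asub.
  apply: (brown_closures_meet FT maxF monM B1 B2 Mn Ba).
    by move=> x /Asub; exact: progression_sub.
  move=> x m m0 nm xa; have [y Ny yx] := progression_nat_dense m0 nm xa.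
  by exists y => //; exact: subA.
split=> [F M FT maxF monM B1 B2 a n Mn Ba|].
  have mainA := main F M FT maxF monM B1 B2 a n Mn Ba.
  split; apply: superconnected_inP; apply: mainA => //;
    exact: progression_nat_sub.
case: hT => _ [F [M [FT maxF monM B1 B2]]].
have M1 : M 1%N by case: monM.
(* Z/1 has a single point, which every nonempty closed set contains; hence level 1 admits any base
   point [a]. *)
have B1a a : Bset F 1 (pi_mod 1 a).
  by move=> C [_ [x Cx]]; rewrite (_ : pi_mod 1 a = x) // (ord1 x) ord1.
have main1 a := main F M FT maxF monM B1 B2 a 1%N M1 (B1a a).
split.
- apply: superconnectedP; apply: (main1 0) => // x _.
  by exists x => //; rewrite add0r mul1r.
- apply: superconnected_inP; apply: (main1 0) => _ [k k0 <-].
    by exists k => //; rewrite add0r mul1r.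
  by exists k%:Z => //; rewrite add0r mul1r.
(* The positive integers are the progression 1 + N, so the base point is 1 instead of 0. *)
- apply: superconnected_inP; apply: (main1 1) => _ [k k0 <-].
    by exists k.+1 => //; rewrite mul1r.
  by exists (k%:Z - 1) => //; rewrite mul1r addrC subrK.
Qed.
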